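(* If $A$ is a strong independence algebra, then $\operatorname{Sub}^{\mathrm f}(A)=\{B\leq A:\operatorname{codim}(B)<\aleph_0\}$, considered as a monoid under $\cap$ (with identity $A$), has presentation $\operatorname{Mon}\langle X_E:R_E\rangle$ via the morphism $\Phi_E:X_E^*\to\operatorname{Sub}^{\mathrm f}(A)$ determined by $x_B\mapsto B$, where $X_E=\{x_B:B\in\operatorname{Max}(A)\}$ is an alphabet in one-one correspondence with the set $\operatorname{Max}(A)$ of maximal (proper) subalgebras of $A$, and $R_E=R_E^1\cup R_E^2\cup R_E^3$ with $$R_E^1=\{(x_B^2,x_B):B\in\operatorname{Max}(A)\},\qquad R_E^2=\{(x_Bx_C,x_Cx_B):B,C\in\operatorname{Max}(A)\},$$ $$R_E^3=\{(x_Bx_C,x_Bx_D):B,C,D\in\operatorname{Max}(A),\ B\cap C=B\cap D\}.$$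
   Context: Let $A$ be a (universal) algebra; $\langle X\rangle$ is the subalgebra generated by $X\subseteq A$, and $B\leq A$ means $B$ is a subalgebra. A nullary operation is identified with a constant, and the empty set is a subalgebra if there are no constants. A subset $X\subseteq A$ is independent if $x\notin\langle X\setminus\{x\}\rangle$ for all $x\in X$; a basis is an independent generating set. $A$ is an independence algebra if: (EP) for all $X\subseteq A$ and $x,y\in A$, if $x\in\langle X\cup\{y\}\rangle$ and $x\notin\langle X\rangle$ then $y\in\langle X\cup\{x\}\rangle$; and (FBP) if $X$ is a basis of $A$, then any map $X\to A$ extends (uniquely) to an endomorphism of $A$. It is strong if (SP) for all independent $X,Y\subseteq A$, $\langle X\rangle\cap\langle Y\rangle=\langle\varnothing\rangle$ implies $X\cup Y$ is independent. For $B\leq A$, a subset $X\subseteq A$ is $B$-independent if $x\notin\langle B\cup(X\setminus\{x\})\rangle$ for all $x\in X$, and is then a $B$-basis of $\langle B\cup X\rangle$. All $B$-bases of $A$ have the same cardinality, denoted $\operatorname{codim}(B)$. The maximal subalgebras are precisely those of codimension $1$. For strong $A$, $\operatorname{Sub}^{\mathrm f}(A)$ is closed under $\cap$. A monoid $T$ has presentation $\operatorname{Mon}\langle X:R\rangle$ via $\phi$ if $\phi:X^*\to T$ is a surjective monoid morphism from the free monoid whose kernel is the congruence on $X^*$ generated by $R\subseteq X^*\times X^*$. *)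

(* Defs.v *)
From mathcomp Require Import all_boot all_classical.

Set Implicit Arguments.
Unset Strict Implicit.
Unset Printing Implicit Defensive.

Local Open Scope classical_set_scope.

(* Universal algebras. The set of (finitary) operation symbols is arbitrary; an
   operation of arity 0 is a constant, since there is exactly one function
   'I_0 -> carrier. *)

Record algebra := Algebra {
  carrier :> Type;
  op_symbol : Type;
  arity : op_symbol -> nat;
  interp : forall o : op_symbol, ('I_(arity o) -> carrier) -> carrier }.

Section Algebra.
Variable A : algebra.
Implicit Types (B X Y : set A) (x y : A).

(* set0 is a subalgebra exactly when there are no constants. *)
Definition subalgebra B : Prop :=
  forall (o : op_symbol A) (a : 'I_(arity o) -> A),
    (forall i, B (a i)) -> B (interp a).

Definition gen X : set A := smallest subalgebra X.

Definition endomorphism (h : A -> A) : Prop :=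
  forall (o : op_symbol A) (a : 'I_(arity o) -> A),
    h (interp a) = interp (h \o a).

Definition independent X : Prop := forall x, X x -> ~ gen (X `\ x) x.

Definition basis X : Prop := independent X /\ gen X = setT.

Definition exchange_property : Prop :=
  forall X x y, gen (X `|` [set y]) x -> ~ gen X x -> gen (X `|` [set x]) y.

Definition free_basis_property : Prop :=
  forall X, basis X -> forall f : X -> A,
    exists! h : A -> A, endomorphism h /\ forall x : X, h (\val x) = f x.

Definition independence_algebra : Prop :=
  exchange_property /\ free_basis_property.

Definition strong_property : Prop :=
  forall X Y, independent X -> independent Y ->
    gen X `&` gen Y = gen set0 -> independent (X `|` Y).

Definition strong_independence_algebra : Prop :=
  independence_algebra /\ strong_property.

Definition rel_independent B X : Prop :=
  forall x, X x -> ~ gen (B `|` (X `\ x)) x.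

(* [rel_basis B X]: X is a B-basis of the whole algebra A. *)
Definition rel_basis B X : Prop :=
  rel_independent B X /\ gen (B `|` X) = setT.

(* codim B < aleph_0, where codim B is the common cardinality of all B-bases
   of A. *)
Definition finite_codim B : Prop := exists2 X, rel_basis B X & finite_set X.

Definition Subf : set (set A) := [set B | subalgebra B /\ finite_codim B].

Definition Max : set (set A) :=
  [set B | [/\ subalgebra B, B <> setT &
    forall C, subalgebra C -> B `<=` C -> C = B \/ C = setT]].

End Algebra.

Arguments Subf : clear implicits.
Arguments Max : clear implicits.

(* The free monoid on an alphabet X is [seq X] under concatenation. *)

Definition congruence (X : Type) (E : set (seq X * seq X)) : Prop :=
  [/\ forall u, E (u, u),
      forall u v, E (u, v) -> E (v, u),
      forall u v w, E (u, v) -> E (v, w) -> E (u, w) &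
      forall u v u' v', E (u, v) -> E (u', v') -> E (u ++ u', v ++ v')].

(* [presents op T R phi]: in the monoid with carrier M, product op and unit e,
   T is a submonoid, and it has presentation Mon<X : R> via phi. *)
Definition presents (M X : Type) (e : M) (op : Monoid.law e) (T : set M)
    (R : set (seq X * seq X)) (phi : seq X -> M) : Prop :=
  [/\ T e /\ (forall s t, T s -> T t -> T (op s t)),
      phi [::] = e /\ (forall u v, phi (u ++ v) = op (phi u) (phi v)),
      range phi = T &
      [set p | phi p.1 = phi p.2] = smallest (@congruence X) R].

Section Presentation.
Variable A : algebra.

(* The alphabet {x_B : B in Max A} is Max A itself, seen as a type. *)
Definition X_E : Type := Max A.

Definition R1_E : set (seq X_E * seq X_E) :=
  [set p | exists B : X_E, p = ([:: B; B], [:: B])].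

Definition R2_E : set (seq X_E * seq X_E) :=
  [set p | exists B C : X_E, p = ([:: B; C], [:: C; B])].

Definition R3_E : set (seq X_E * seq X_E) :=
  [set p | exists B C D : X_E,
    \val B `&` \val C = \val B `&` \val D /\ p = ([:: B; C], [:: B; D])].

Definition R_E : set (seq X_E * seq X_E) := R1_E `|` R2_E `|` R3_E.

Definition Phi_E (w : seq X_E) : set A :=
  \big[setI/setT]_(B <- w) \val B.

End Presentation.

Arguments R_E : clear implicits.
Arguments Phi_E : clear implicits.

(* Main.v *)
Require Import Defs.
From mathcomp Require Import all_boot all_classical.

(** Write [E] for the congruence generated by the relations.  They hold under
    intersection, so everything rests on the converse: words [u] and [v] with
    the same intersection are [E]-related.  It suffices to know the absorption
    principle, that a letter [M] with [Phi_E A w `<=` M] can be put in front of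
    [w] without leaving its class ([absorb_letter]): then [v] absorbs into [u],
    [u] absorbs into [v], and [u ++ v] and [v ++ u] are related because letters
    commute.

    Absorption is proved by induction on the word.  Let the word be [B :: w],
    put [N := Phi_E A w], and suppose that neither [B] nor [N] lies below [M].
    The third family of relations lets one exchange [M], standing next to [B],
    for any maximal [D] with [B `&` D = B `&` M].  There is such a [D] above
    [N], namely the join of [M `&` B] and [N] ([exchange_maximal]), and [D] is
    absorbed by [w] by induction.

    That this join is maximal and meets [B] in [M `&` B] is a statement about
    the lattice of subalgebras: it follows from the modular law
    ([gen_modular]), which is where the strong property enters.  The modular
    law also shows that meeting with a maximal subalgebra preserves finite
    codimension.  Conversely a subalgebra [B] with a finite [B]-basis [X] is
    the intersection of the maximal subalgebras generated by [B] and [X]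
    minus one point, by the exchange property alone. *)

Section StrongIndependenceAlgebra.

Set Implicit Arguments.
Unset Strict Implicit.
Unset Printing Implicit Defensive.
Local Open Scope classical_set_scope.

Variable A : algebra.
Implicit Types (B C D M N P Q R S X Y : set A) (b x y z : A).

(** * Generated subalgebras *)

Lemma subalgebra_gen X : subalgebra (gen X).
Proof.
by move=> o a Xa S [subS XS]; apply: (subS) => i; apply: (Xa i).
Qed.

Lemma subset_gen X : X `<=` gen X.
Proof. exact: sub_gen_smallest. Qed.

Lemma gen_subset X S : subalgebra S -> X `<=` S -> gen X `<=` S.
Proof. exact: smallest_sub. Qed.

Lemma gen_subset_gen X Y : X `<=` gen Y -> gen X `<=` gen Y.
Proof. by apply: gen_subset; apply: subalgebra_gen. Qed.

Lemma gen_mono X Y : X `<=` Y -> gen X `<=` gen Y.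
Proof. by move=> XY; apply: gen_subset_gen => x /XY; apply: subset_gen. Qed.

Lemma gen_subalgebra S : subalgebra S -> gen S = S.
Proof. by move=> subS; apply: smallest_id. Qed.

Lemma subalgebraI B C : subalgebra B -> subalgebra C -> subalgebra (B `&` C).
Proof.
by move=> subB subC o a BCa; split; [apply: subB | apply: subC] => i;
  case: (BCa i).
Qed.

(** Operations take finitely many arguments, so those drawn from a chain all
    lie in one member of it. *)
Lemma gen_bigcup_chain (F : set (set A)) Y0 :
  F Y0 -> total_on F subset ->
  gen (\bigcup_(Y in F) Y) `<=` \bigcup_(Y in F) gen Y.
Proof.
move=> FY0 totF; apply: gen_subset; last first.
  by move=> x [Y FY Yx]; exists Y => //; apply: subset_gen.
move=> o a Fa.
suff [Y FY Ya] : exists2 Y, F Y & forall i, gen Y (a i).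
  by exists Y => //; apply: subalgebra_gen.
suff [Y FY Ya] : exists2 Y, F Y &
    forall i, i \in enum 'I_(arity o) -> gen Y (a i).
  by exists Y => // i; apply: Ya; rewrite mem_enum.
elim: (enum _) => [|j s [Y FY Ys]]; first by exists Y0.
have [Z FZ Zj] := Fa j.
have [YZ | ZY] := totF _ _ FY FZ.
- exists Z => // i; rewrite inE => /orP[/eqP -> // | /Ys]; exact: gen_mono.
- exists Y => // i; rewrite inE => /orP[/eqP -> | /Ys //]; exact: (gen_mono ZY).
Qed.

(** * Consequences of the exchange property *)

Section Exchange.

Hypothesis EP : exchange_property A.

Lemma independentU1 X x :
  independent X -> ~ gen X x -> independent (X `|` [set x]).
Proof.
move=> indX Xx y [Xy | ->]; last first.
  by apply: contra_not Xx; apply: gen_mono => z [[] // -> []].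
have nyx : y <> x by move=> yx; apply: Xx; rewrite -yx; apply: subset_gen.
move=> yX; have : gen ((X `\ y) `|` [set x]) y.
  by apply: gen_mono yX => z [[Xz | ->] zy]; [left | right].
move=> /EP /(_ (indX y Xy)) xX; apply: Xx; apply: gen_mono xX => z.
by case=> [[] | ->].
Qed.

(** The set is maximal, by Zorn's lemma, among the independent subsets of [Q]
    whose span meets that of [S] trivially.  An element of [Q] outside the
    span of [X] and [S] could be added to it: by exchange a new element in the
    span of [S] would put it inside. *)
Lemma exists_complement S Q : exists X,
  [/\ X `<=` Q, independent X, gen X `&` gen S `<=` gen set0 &
      Q `<=` gen (X `|` S)].
Proof.
pose good X := [/\ X `<=` Q, independent X & gen X `&` gen S `<=` gen set0].
have [F Fgood totF | X [[XQ indX XS] maxX]] := @Zorn_bigcup A good.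
  have [[Y0 FY0] | F0] := pselect (F !=set0); last first.
    have -> : \bigcup_(Y in F) Y = set0.
      by apply/seteqP; split=> // x [Y FY _]; apply: F0; exists Y.
    by split=> // x [].
  have genF := gen_bigcup_chain FY0 totF.
  split=> [x [Y /Fgood[YQ _ _] /YQ] // | x [Y FY Yx] | x [/genF[Y FY Yx] Sx]].
  - have -> : (\bigcup_(Z in F) Z) `\ x = \bigcup_(Z in [set Z `\ x | Z in F]) Z.
      apply/seteqP; split=> [y [[Z FZ Zy] yx] | y [_ [Z FZ <-] [Zy yx]]].
        by exists (Z `\ x) => //; exists Z.
      by split=> //; exists Z.
    have FYx : [set Z `\ x | Z in F] (Y `\ x) by exists Y.
    move=> /(gen_bigcup_chain FYx) [|_ [Z FZ <-] Zx].
    + move=> _ _ [Z FZ <-] [Z' FZ' <-].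
      by case: (totF _ _ FZ FZ') => ZZ; [left | right] => y [/ZZ].
    + (* The larger of [Y] and [Z] contains [x] in the span of the rest. *)
      have [YZ | ZY] := totF _ _ FY FZ.
        by have [_ indZ _] := Fgood _ FZ; apply: indZ Zx; apply: YZ.
      have [_ indY _] := Fgood _ FY; apply: indY Yx _.
      by apply: gen_mono Zx => y [/ZY].
  - by have [_ _ YS] := Fgood _ FY; apply: YS.
exists X; split=> // q Qq; apply: contrapT => XSq.
have Xq : ~ gen X q by apply: contra_not XSq; apply: gen_mono => x; left.
apply: (maxX (X `|` [set q])).
  split; first by move=> x; left.
  by move=> /(_ q (or_intror erefl)) /subset_gen.
split=> [x [/XQ // | -> //] | | z [Xqz Sz]]; first exact: independentU1.
have [Xz | Xz] := pselect (gen X z); first exact: XS.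
case: XSq; apply: gen_subset_gen (EP Xqz Xz) => x [Xx | ->].
  by apply: subset_gen; left.
by apply: gen_mono Sz => ?; right.
Qed.

(** The case of a trivial [S] in [exists_complement]. *)
Lemma exists_basis S : exists X,
  [/\ X `<=` S, independent X & gen X = gen S].
Proof.
have [X [XS indX _ SX]] := exists_complement set0 S.
exists X; split=> //; rewrite setU0 in SX.
apply/seteqP; split; [exact: gen_mono | exact: gen_subset_gen].
Qed.

Lemma gen_setU1_Max D b :
  subalgebra D -> ~ D b -> gen (D `|` [set b]) = setT -> Max A D.
Proof.
move=> subD Db DbT; split=> //; first by move=> DT; apply: Db; rewrite DT.
move=> C subC DC; have [CD | CD] := pselect (C `<=` D).
  by left; apply/seteqP; split.
have [c [Cc Dc]] := nonsubset CD.
have bDc : gen (D `|` [set c]) b.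
  by apply: EP; [rewrite DbT | rewrite gen_subalgebra].
right; apply/seteqP; split=> // x _.
have : gen (D `|` [set b]) x by rewrite DbT.
apply: gen_subset => // y [/DC // | ->].
by apply: gen_subset bDc => // z [/DC // | ->].
Qed.

End Exchange.

Lemma Max_gen_setU1 M b : Max A M -> ~ M b -> gen (M `|` [set b]) = setT.
Proof.
move=> [subM _ maxM] Mb.
have [||eqM | //] := maxM (gen (M `|` [set b])).
- exact: subalgebra_gen.
- by move=> x Mx; apply: subset_gen; left.
- by case: Mb; rewrite -eqM; apply: subset_gen; right.
Qed.

(** * Finite codimension *)

(** A finite relative generating set can be thinned to a relative basis one
    point at a time: a point that depends on [B] and the points after it is
    dropped, any other is kept and joins [B]. *)
Lemma exists_rel_basis (s : seq {classic A}) B :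
  gen (B `|` [set` s]) = setT -> exists2 X, X `<=` [set` s] & rel_basis B X.
Proof.
elim: s B => [|x s IHs] B gs.
  exists set0 => //; split=> [x [] // |].
  by rewrite -gs; congr (gen (_ `|` _)); apply/seteqP; split.
have [Bsx | Bsx] := pselect (gen (B `|` [set` s]) x).
  have [|X Xs basX] := IHs B; last first.
    by exists X => // y /Xs /= ys; rewrite inE ys orbT.
  apply/seteqP; split=> // y _.
  have : gen (B `|` [set` x :: s]) y by rewrite gs.
  apply: gen_subset_gen => z [Bz | /=]; first by apply: subset_gen; left.
  by rewrite inE => /orP[/eqP -> // | zs]; apply: subset_gen; right.
have [|X Xs [indX genX]] := IHs (B `|` [set x]).
  apply/seteqP; split=> // y _.
  have : gen (B `|` [set` x :: s]) y by rewrite gs.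
  apply: gen_mono => z [Bz | /=]; first by left; left.
  by rewrite inE => /orP[/eqP -> | zs]; [left; right | right].
exists (x |` X).
  by move=> y [-> | /Xs /= ys] /=; rewrite inE ?eqxx // ys orbT.
split; last by rewrite setUA.
move=> y [-> | Xy].
  apply: contra_not Bsx; apply: gen_mono => z [Bz | [[-> [] // | /Xs zs _]]].
    by left.
  by right.
apply: contra_not (indX y Xy); apply: gen_mono => z.
by case=> [Bz | [[-> | Xz] zy]]; [left; left | left; right | right].
Qed.

Lemma finite_codim_gen B X :
  finite_set X -> gen (B `|` X) = setT -> finite_codim B.
Proof.
move=> finX BX; have /(@finite_seqP {classic A})[s Xs] := finX.
rewrite Xs in BX; have [Y Ys basY] := exists_rel_basis BX.
by exists Y => //; apply: sub_finite_set Ys _; rewrite -[X in finite_set X]Xs.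
Qed.

(** This lets points of a relative basis be removed one after the other, each
    at the price of one maximal subalgebra.  If [y] is generated by [B] and [Y],
    and also by [B] and [X `\ x], but not by [B] and [Y `\ x], then by exchange
    [x] is generated by [B], [Y `\ x] and [y], hence by [B] and [X `\ x]. *)
Lemma gen_setD1I B X Y x : exchange_property A -> rel_independent B X ->
  X x -> Y `<=` X ->
  gen (B `|` (X `\ x)) `&` gen (B `|` Y) = gen (B `|` (Y `\ x)).
Proof.
move=> EP indX Xx YX; apply/seteqP; split=> y; last first.
  by move=> Yy; split; apply: gen_mono Yy => z [Bz | [Yz zx]];
    [left | right; split=> //; apply: YX | left | right].
move=> [Xy Yy]; apply: contrapT => Yxy; apply: (indX x Xx).
have : gen ((B `|` (Y `\ x)) `|` [set y]) x.
  apply: EP Yxy; apply: gen_mono Yy => z [Bz | Yz]; first by left; left.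
  by have [-> | zx] := pselect (z = x); [right | left; right].
apply: gen_subset_gen => z [[Bz | [Yz zx]] | -> //]; apply: subset_gen.
  by left.
by right; split=> //; apply: YX.
Qed.

Lemma Max_rel_basisD1 B X x : exchange_property A -> rel_basis B X -> X x ->
  Max A (gen (B `|` (X `\ x))).
Proof.
move=> EP [indX BX] Xx; apply: (gen_setU1_Max EP (b := x)).
- exact: subalgebra_gen.
- exact: indX.
apply/seteqP; split=> // y _; have : gen (B `|` X) y by rewrite BX.
apply: gen_mono => z [Bz | Xz]; first by left; apply: subset_gen; left.
have [-> | zx] := pselect (z = x); first by right.
by left; apply: subset_gen; right.
Qed.

(** * The modular law *)

Section Strong.

Hypothesis EP : exchange_property A.
Hypothesis SP : strong_property A.

(** Let [K] be a complement of [Q `&` R] in [Q]; then [gen K] meets [R]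
    trivially, so by the strong property [K] is independent over any
    independent subset of [R].  Suppose that [x] in [R] is generated by [P] and
    [Q], hence by [P1 := gen (P `|` (Q `&` R))] and [K], but not by [P1].  Then
    a basis of [P1] together with [x] is such a subset, a contradiction. *)
Lemma gen_modular P Q R : subalgebra Q -> subalgebra R -> P `<=` R ->
  gen (P `|` Q) `&` R `<=` gen (P `|` (Q `&` R)).
Proof.
move=> subQ subR PR x [PQx Rx]; apply: contrapT => P1x.
have [K [KQ indK KQR QK]] := exists_complement EP (Q `&` R) Q.
have [J [/subset_trans/(_ (@subset_gen _)) JP1 indJ genJ]] :=
  exists_basis EP (P `|` (Q `&` R)).
have P1R : gen (P `|` (Q `&` R)) `<=` R.
  by apply: gen_subset => // z [/PR | []].
have indJx : independent (J `|` [set x]).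
  by apply: independentU1 => //; rewrite genJ.
have indJxK : independent ((J `|` [set x]) `|` K).
  apply: SP => //; apply/seteqP; split=> [z [Jxz Kz] | z z0].
    have Qz : Q z by apply: gen_subset Kz.
    apply: KQR; split=> //; apply: subset_gen; split=> //.
    by apply: gen_subset Jxz => // y [/JP1 /P1R | ->].
  by split; apply: gen_mono z0.
apply: (indJxK x); first by left; right.
have JKx : gen (J `|` K) x.
  apply: gen_subset_gen PQx => z [Pz | /QK].
    have : gen J z by rewrite genJ; apply: subset_gen; left.
    by apply: gen_mono => y; left.
  apply: gen_subset_gen => y [Ky | QRy]; first by apply: subset_gen; right.
  have : gen J y by rewrite genJ; apply: subset_gen; right.
  by apply: gen_mono => ?; left.
apply: gen_mono JKx => z JKz; split.
  by case: JKz => [Jz | Kz]; [left; left | right].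
move=> zx; rewrite zx in JKz; apply: P1x.
case: JKz => [/JP1 // | Kx].
by apply: subset_gen; right; split=> //; apply: KQ.
Qed.

(** Meeting with a maximal subalgebra cuts down by at most one dimension; this
    is the modular law applied to the join of [M] and a point [b] outside it,
    which is all of [A]. *)
Lemma subset_gen_MaxI B M b : subalgebra B -> Max A M -> B b -> ~ M b ->
  B `<=` gen ((M `&` B) `|` [set b]).
Proof.
move=> subB maxM Bb Mb x Bx; rewrite setUC.
have [subM _ _] := maxM.
apply: gen_modular => //; first by move=> y ->.
by split=> //; rewrite setUC (Max_gen_setU1 maxM Mb).
Qed.

Lemma finite_codim_MaxI B M : subalgebra B -> Max A M -> finite_codim B ->
  finite_codim (M `&` B).
Proof.
move=> subB maxM codB; have [/setIidr -> // | /nonsubset[b [Bb Mb]]] :=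
  pselect (B `<=` M).
have [X [_ BX] finX] := codB.
apply: (@finite_codim_gen _ ([set b] `|` X)).
  by rewrite finite_setU; split=> //; apply: finite_set1.
apply/seteqP; split=> // y _; have : gen (B `|` X) y by rewrite BX.
apply: gen_subset_gen => z [/(subset_gen_MaxI subB maxM Bb Mb) | Xz].
  by rewrite setUA; apply: gen_mono => ?; left.
by apply: subset_gen; right; right.
Qed.

(** The required algebra is the join of [M `&` B] and [N].  The modular law
    gives its intersection with [B].  Take [b] in [B] outside [M] and [n] in
    [N] outside [M], hence outside [B].  Adding [b] to the join gives all of
    [B], then with [n] all of [A]; so the join is maximal. *)
Lemma exchange_maximal B M N : Max A B -> Max A M -> subalgebra N ->
  ~ B `<=` M -> ~ N `<=` M -> B `&` N `<=` M ->
  exists2 D, Max A D & N `<=` D /\ B `&` D = B `&` M.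
Proof.
move=> maxB maxM subN /nonsubset[b [Bb Mb]] /nonsubset[n [Nn Mn]] BNM.
have [subB _ _] := maxB; have [subM _ _] := maxM.
have Bn : ~ B n by move=> Bn; apply: Mn; apply: BNM.
pose D := gen ((M `&` B) `|` N).
have MBD : M `&` B `<=` D by move=> x ?; apply: subset_gen; left.
have ND : N `<=` D by move=> x ?; apply: subset_gen; right.
have DBM : D `&` B `<=` M.
  move=> x [Dx Bx].
  have MBR : M `&` B `<=` B by move=> ? [].
  have := gen_modular subN subB MBR (conj Dx Bx).
  by apply: gen_subset => // z [[] // | [Nz Bz]]; apply: BNM.
exists D; last first.
  split=> //; apply/seteqP; split=> x [Bx].
    by move=> Dx; split=> //; apply: DBM.
  by move=> Mx; split=> //; apply: MBD.
apply: (gen_setU1_Max EP (b := b)); first exact: subalgebra_gen.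
  by move=> Db; apply: Mb; apply: DBM.
apply/seteqP; split=> // x _.
have : gen (B `|` [set n]) x by rewrite (Max_gen_setU1 maxB Bn).
apply: gen_subset_gen => y [/(subset_gen_MaxI subB maxM Bb Mb) | ->].
  by apply: gen_mono => z [/MBD | ->]; [left | right].
by apply: subset_gen; left; apply: ND.
Qed.

(** * The presentation *)

Lemma Phi_E_cons (B : X_E A) w : Phi_E A (B :: w) = \val B `&` Phi_E A w.
Proof. exact: big_cons. Qed.

Lemma Phi_E_cat u v : Phi_E A (u ++ v) = Phi_E A u `&` Phi_E A v.
Proof. exact: big_cat. Qed.

Lemma Subf_Phi_E w : Subf A (Phi_E A w).
Proof.
elim: w => [|B w [subw codw]].
  rewrite /Phi_E big_nil; split=> //; exists set0 => //.
  by split=> [x [] |]; rewrite // setU0 gen_subalgebra.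
have maxB : Max A (\val B) := set_valP B; have [subB _ _] := maxB.
by rewrite Phi_E_cons; split; [apply: subalgebraI | apply: finite_codim_MaxI].
Qed.

Lemma exists_word B : Subf A B -> exists w, Phi_E A w = B.
Proof.
move=> [subB [X basX finX]]; have [indX BX] := basX.
have /(@finite_seqP {classic A})[s Xs] := finX.
have sX : [set` s] `<=` X by rewrite Xs.
suff [w ws] : exists w, Phi_E A w = gen (B `|` (X `\` [set` s])).
  by exists w; rewrite ws [X in X `\` _]Xs setDv setU0 gen_subalgebra.
elim: s {Xs} sX => [|x s IHs] sX.
  exists [::]; rewrite /Phi_E big_nil -BX; congr (gen (_ `|` _)).
  by apply/seteqP; split=> [y Xy | y []].
have Xx : X x by apply: sX => /=; rewrite inE eqxx.
have [|w ws] := IHs.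
  by move=> y /= ys; apply: sX => /=; rewrite inE ys orbT.
have maxM := Max_rel_basisD1 EP basX Xx.
exists (SigSub (mem_set maxM) :: w); rewrite Phi_E_cons ws /=.
rewrite (gen_setD1I EP indX Xx) => [|y [] //].
congr (gen (_ `|` _)); apply/seteqP; split=> y [].
- by move=> [Xy sy] yx; split=> //=; rewrite inE => /orP[/eqP | /sy].
- by move=> Xy /= sy; split; [split=> // ys | move=> yx]; apply: sy;
    rewrite inE ?ys ?orbT // yx eqxx.
Qed.

Section Congruence.

Variable E : set (seq (X_E A) * seq (X_E A)).
Hypotheses (congE : congruence E) (RE : R_E A `<=` E).

Lemma congruence_catl u v w : E (v, w) -> E (u ++ v, u ++ w).
Proof. by case: congE => reflE _ _ catE; apply: catE. Qed.

Lemma congruence_catr u v w : E (u, v) -> E (u ++ w, v ++ w).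
Proof. by case: congE => reflE _ _ catE uv; apply: catE. Qed.

Lemma congruence_swap (B C : X_E A) w : E (B :: C :: w, C :: B :: w).
Proof.
by apply: (@congruence_catr [:: B; C] [:: C; B]); apply: RE; left; right;
  exists B, C.
Qed.

(** Bring [M] next to the first letter [B] of the word and exchange it there
    for a maximal [D] that the remaining letters absorb by induction.  If [M]
    itself contains their intersection, [D] is [M]; if it contains [B], [D] is
    [B], which idempotency absorbs; otherwise [exchange_maximal] provides it. *)
Lemma absorb_letter w (M : X_E A) : Phi_E A w `<=` \val M -> E (M :: w, w).
Proof.
have [_ _ trE _] := congE.
elim: w M => [|B w IHw] M.
  have [_ MT _] : Max A (\val M) := set_valP M.
  rewrite /Phi_E big_nil => TM; case: MT; exact/seteqP.
rewrite Phi_E_cons => BwM; apply: (trE _ _ _ (congruence_swap M B w)).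
have [wM | wM] := pselect (Phi_E A w `<=` \val M).
  by apply: (@congruence_catl [:: B]); apply: IHw.
(* By the third family, next to [B] only the intersection with [B] matters. *)
have exch (D : X_E A) : \val B `&` \val M = \val B `&` \val D ->
    E (B :: M :: w, B :: D :: w).
  move=> BMD; apply: (@congruence_catr [:: B; M] [:: B; D]).
  by apply: RE; right; exists B, M, D.
have [BM | BM] := pselect (\val B `<=` \val M).
  apply: (trE _ (B :: B :: w)).
    by apply: exch; rewrite setIid; apply/setIidl.
  apply: (@congruence_catr [:: B; B] [:: B]).
  by apply: RE; left; left; exists B.
have [D maxD [wD BDM]] := exchange_maximal (set_valP B) (set_valP M)
  (proj1 (Subf_Phi_E w)) BM wM BwM.
apply: (trE _ (B :: SigSub (mem_set maxD) :: w)); first by apply: exch.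
by apply: (@congruence_catl [:: B]); apply: IHw.
Qed.

Lemma absorb_word u w : Phi_E A w `<=` Phi_E A u -> E (u ++ w, w).
Proof.
have [reflE _ trE _] := congE.
elim: u => [|B u IHu] //; rewrite Phi_E_cons => wBu.
apply: (trE _ (B :: w)).
  by apply: (@congruence_catl [:: B]); apply: IHu => x /wBu[].
by apply: absorb_letter => x /wBu[].
Qed.

Lemma congruence_catC u v : E (u ++ v, v ++ u).
Proof.
have [reflE _ trE _] := congE.
elim: u => [|B u IHu]; first by rewrite cats0.
apply: (trE _ (B :: v ++ u)); first exact: (@congruence_catl [:: B]).
elim: v {IHu} => [|C v IHv] //=.
apply: (trE _ _ _ (congruence_swap B C _)).
exact: (@congruence_catl [:: C]).
Qed.

Lemma congruence_of_eq_Phi_E u v : Phi_E A u = Phi_E A v -> E (u, v).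
Proof.
have [_ symE trE _] := congE => uv.
have vu_u : E (v ++ u, u) by apply: absorb_word; rewrite uv.
have uv_v : E (u ++ v, v) by apply: absorb_word; rewrite uv.
apply: (trE _ _ _ (symE _ _ vu_u)).
exact: (trE _ _ _ (congruence_catC v u) uv_v).
Qed.

End Congruence.

End Strong.

Lemma congruence_ker_Phi_E : congruence [set p | Phi_E A p.1 = Phi_E A p.2].
Proof.
split=> //= [u v w -> // | u v u' v' uv uv'].
by rewrite !Phi_E_cat uv uv'.
Qed.

Lemma R_E_sub_ker_Phi_E : R_E A `<=` [set p | Phi_E A p.1 = Phi_E A p.2].
Proof.
move=> p [[[B ->] | [B [C ->]]] | [B [C [D [BCD ->]]]]] /=;
  rewrite /Phi_E !big_cons big_nil !setIT //.
- by rewrite setIid.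
- by rewrite setIC.
Qed.

End StrongIndependenceAlgebra.

Theorem theorem8p40 (A : algebra) (hA : strong_independence_algebra A) :
  presents (M := set A) (e := setT) setI (Subf A) (R_E A) (Phi_E A).
Proof.
have [[EP _] SP] := hA.
have rangePhi : range (Phi_E A) = Subf A.
  apply/seteqP; split=> [_ [w _ <-] | B /(exists_word EP)[w <-]].
    exact: Subf_Phi_E.
  by exists w.
split=> //.
- split; first by rewrite -rangePhi; exists nil => //; rewrite /Phi_E big_nil.
  rewrite -rangePhi => _ _ [u _ <-] [v _ <-].
  by exists (u ++ v) => //; rewrite Phi_E_cat.
- by split=> [|u v]; [rewrite /Phi_E big_nil | rewrite Phi_E_cat].
- apply/seteqP; split.
    by move=> [u v] uv E [congE RE]; apply: congruence_of_eq_Phi_E.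
  apply: smallest_sub; last exact: R_E_sub_ker_Phi_E.
  exact: congruence_ker_Phi_E.
Qed.
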